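(* Given limiting arrival rates $\Lambda$, service rates $\mu$, slacks $\Gamma$, and CRP components $\{\mathbb{C}_1,\dots,\mathbb{C}_{K'},\mathbb{C}_{K'+1},\dots,\mathbb{C}_K\}$, there is a permutation of CRP components $\sigma$ that minimises, across all admissible topological orders, the average expected delay $$\bar w_\sigma=\sum_{\kappa=1}^{K'}\frac{\sum_{k=1}^{\kappa}\widetilde\mu_{\sigma(k)}}{\sum_{\ell=1}^{\kappa}\widetilde\gamma_{\mathrm{comps}(\sigma,\ell)}}.$$ The DAG or menu that will minimise delays is one that only allows for this topological order.
   Context: There are $n$ customer classes and $m$ servers with service rates $\mu_j$; $[k]=\{1,\dots,k\}$, $|x|=\sum_i x_i$. A menu is a matrix $M=[m_{ij}]\in\{0,1\}^{n\times m}$; class $i$ can be served by server $j$ iff $m_{ij}=1$. Heavy-traffic assumption: arrival rates are $\lambda_i^{(\epsilon)}=\Lambda_i-\Gamma_i\epsilon+o(\epsilon)\ge0$ for $i\in[n]$, $0<\epsilon<\epsilon_+$, with $\Lambda\in\mathbb{R}_+^n$, $\Gamma\in\mathbb{R}^n$, $|\Lambda|=|\mu|$, $|\Gamma|>0$, and $\Gamma_i<0$ whenever $\Lambda_i=0$. Admissible menus. For $S\subseteq[m]$, $U_S(M)=\{i:\sum_{j\in S^c}m_{ij}=0\}$ and $\Delta^{(\epsilon)}_S(M)=\sum_{j\in S}\mu_j-\sum_{i\in U_S(M)}\lambda_i^{(\epsilon)}$. $M$ is admissible if $\Delta^{(\epsilon)}_S(M)=\Omega(\epsilon)$ for all $S\subseteq[m]$.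 CRP components. $\mathcal{F}(0,\Lambda,M)$ is the set of $f=[f_{ij}]\ge0$ with $\sum_i f_{ij}\le\mu_j$, $\sum_j f_{ij}=\Lambda_i$, and $f_{ij}=0$ whenever $m_{ij}=0$. The residual matching $\breve M$ has $\breve m_{ij}=1$ iff some $f\in\mathcal{F}(0,\Lambda,M)$ has $f_{ij}>0$. The CRP components $\mathbb{C}_k=(\mathcal{C}_k,\mathcal{S}_k)$, $k\in[K]$, induced by $M$ are the connected components of the bipartite graph of $\breve M$ (classes $\mathcal{C}_k$, servers $\mathcal{S}_k$). Let $\widetilde\Lambda_k=\sum_{i\in\mathcal{C}_k}\Lambda_i$, $\widetilde\gamma_k=\sum_{i\in\mathcal{C}_k}\Gamma_i$, $\widetilde\mu_k=\sum_{j\in\mathcal{S}_k}\mu_j$, $\mathcal{I}_0=\{k:\widetilde\Lambda_k=0\}$ (components consisting of a single class and no servers), $K'=K-|\mathcal{I}_0|$, indexed so that $[K]\setminus\mathcal{I}_0=[K']$. DAG. The directed acyclic graph $\mathcal{D}$ on $[K]$ associated with $M$ has an arc from $k_1$ to $k_2\ne k_1$ iff $m_{ij}=1$ for some $i\in\mathcal{C}_{k_1}$, $j\in\mathcal{S}_{k_2}$; $k_1\rightsquigarrow k_2$ means there is a directed path. The topological orders allowed by $\mathcal{D}$ are the permutations $\sigma$ of $[K']$ such that $k_1\rightsquigarrow k_2$ implies $\sigma^{-1}(k_2)<\sigma^{-1}(k_1)$. For $k\in[K']$, $\mathrm{comps}(\sigma,k)=\{\sigma(k)\}\cup\{\kappa\in\mathcal{I}_0:k=\max\{k'\in[K']:\kappa\rightsquigarrow\sigma(k')\}\}$,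 and $\widetilde\gamma_{\mathrm{comps}(\sigma,\ell)}=\sum_{\kappa\in\mathrm{comps}(\sigma,\ell)}\widetilde\gamma_\kappa$. Admissible topological orders. A topological order $\sigma$ is admissible for the given rates and CRP components if $\sum_{\ell=1}^{k}\widetilde\gamma_{\sigma(\ell)}>0$ for all $k\in[K']$. Delays. The design problem is to choose an admissible menu (equivalently, its DAG) with the collection of CRP components held fixed. $\bar w_\sigma$ is the average delay across all classes conditional on the topological order $\sigma$. If $\sigma_1,\dots,\sigma_T$ are the topological orders allowed by $M$ and $\mathbb{Q}(\sigma)=\prod_{\kappa\in[K']}\big(\sum_{\ell=1}^{\kappa}\widetilde\gamma_{\mathrm{comps}(\sigma,\ell)}\big)^{-1}$, the average expected (limiting, scaled) delay of $M$, which is the delay to be minimised, is $$\bar W=\frac1{|\mu|}\sum_{t=1}^{T}\frac{\mathbb{Q}(\sigma_t)}{\mathbb{Q}(\sigma_1)+\cdots+\mathbb{Q}(\sigma_T)}\,\bar w_{\sigma_t}.$$ *)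

(* Defs.v *)
From HB Require Import structures.
From mathcomp Require Import all_boot all_order all_algebra all_fingroup.
From mathcomp Require Import all_classical all_reals all_analysis.
Set Implicit Arguments.
Unset Strict Implicit.
Unset Printing Implicit Defensive.
Import Order.TTheory GRing.Theory Num.Theory.
Import numFieldNormedType.Exports.
Local Open Scope classical_set_scope.
Local Open Scope ring_scope.

(* Classes are 'I_n, servers are 'I_m; M i j says that class i can be served
   by server j. *)
Definition menu (n m : nat) := 'M[bool]_(n, m).

Definition only_served_by (n m : nat) (M : menu n m) (S : {set 'I_m}) :
    {set 'I_n} :=
  [set i | (\sum_(j in ~: S) M i j == 0)%N]%SET.

Definition slack (R : realType) (n m : nat) (mu : 'I_m -> R)
    (lam : 'I_n -> R -> R) (M : menu n m) (S : {set 'I_m}) (eps : R) : R :=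
  \sum_(j in S) mu j - \sum_(i in only_served_by M S) lam i eps.

(* f(eps) = Omega(eps) as eps decreases to 0, in the signed sense
   liminf f(eps) / eps > 0: the slack must be positive, whereas the relation
   =Omega_F of mathcomp-analysis only bounds the absolute value. *)
Definition Omega_eps (R : realType) (f : R -> R) : Prop :=
  exists2 c : R, 0 < c & \forall eps \near 0^'+, c * eps <= f eps.

(* If S and only_served_by M S are both empty the slack is identically 0, as a
   difference of two empty sums, and nothing is required.  The case where S is empty is
   still meaningful: it forbids classes that no server can serve. *)
Definition admissible_menu (R : realType) (n m : nat) (mu : 'I_m -> R)
    (lam : 'I_n -> R -> R) (M : menu n m) : Prop :=
  forall S : {set 'I_m}, (S != finset.set0) || (only_served_by M S != finset.set0) ->
    Omega_eps (slack mu lam M S).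

Definition flows (R : realType) (n m : nat) (mu : 'I_m -> R) (Lam : 'I_n -> R)
    (M : menu n m) : set 'M[R]_(n, m) :=
  [set f | [/\ forall i j, 0 <= f i j,
               forall j, \sum_i f i j <= mu j,
               forall i, \sum_j f i j = Lam i
             & forall i j, M i j = false -> f i j = 0]].

Definition residual (R : realType) (n m : nat) (mu : 'I_m -> R)
    (Lam : 'I_n -> R) (M : menu n m) : menu n m :=
  \matrix_(i, j) `[< exists2 f, flows mu Lam M f & 0 < f i j >].

Definition bipartite_edge (n m : nat) (B : menu n m) : rel ('I_n + 'I_m) :=
  fun u v => match u, v with
             | inl i, inr j => B i j
             | inr j, inl i => B i j
             | _, _ => false
             end.

(* The CRP components (C_k, S_k) induced by M, as an unindexed set. *)
Definition crp_components (R : realType) (n m : nat) (mu : 'I_m -> R)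
    (Lam : 'I_n -> R) (M : menu n m) : {set {set 'I_n} * {set 'I_m}} :=
  let conn := connect (bipartite_edge (residual mu Lam M)) in
  [set ([set i | conn u (inl i)], [set j | conn u (inr j)])
     | u : 'I_n + 'I_m]%SET.

(* C is a repetition-free indexing of the CRP components induced by M. *)
Definition induces (R : realType) (n m K : nat) (mu : 'I_m -> R)
    (Lam : 'I_n -> R) (M : menu n m)
    (C : 'I_K -> {set 'I_n} * {set 'I_m}) : Prop :=
  injective C /\ [set C k | k : 'I_K]%SET = crp_components mu Lam M.

(* Lambda~_k and gamma~_k for x = Lambda and x = Gamma. *)
Definition class_total (R : realType) (n m K : nat)
    (C : 'I_K -> {set 'I_n} * {set 'I_m}) (x : 'I_n -> R) (k : 'I_K) : R :=
  \sum_(i in (C k).1) x i.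

(* mu~_k *)
Definition server_total (R : realType) (n m K : nat)
    (C : 'I_K -> {set 'I_n} * {set 'I_m}) (mu : 'I_m -> R) (k : 'I_K) : R :=
  \sum_(j in (C k).2) mu j.

Definition dag (n m K : nat) (C : 'I_K -> {set 'I_n} * {set 'I_m})
    (M : menu n m) : rel 'I_K :=
  fun k1 k2 => (k2 != k1) &&
    [exists i in (C k1).1, exists j in (C k2).2, M i j].

(* Directed path with at least one arc. *)
Definition leads_to (K : nat) (D : rel 'I_K) : rel 'I_K :=
  fun k1 k2 => [exists k, D k1 k && connect D k k2].

(* Components are indexed by 'I_(K1 + K0), K1 being the K' of the model:
   [K'] is the image of lshift K0.  Positions in an order are counted from 0,
   so sum_{l = 1}^{k} becomes \sum_(l < K1 | l <= k). *)
Definition topological_order (K1 K0 : nat) (D : rel 'I_(K1 + K0))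
    (sigma : 'S_K1) : Prop :=
  forall k1 k2 : 'I_K1, leads_to D (lshift K0 k1) (lshift K0 k2) ->
    ((sigma^-1)%g k2 < (sigma^-1)%g k1)%N.

Definition comps (K1 K0 : nat) (D : rel 'I_(K1 + K0)) (I0 : {set 'I_(K1 + K0)})
    (sigma : 'S_K1) (k : 'I_K1) : {set 'I_(K1 + K0)} :=
  (lshift K0 (sigma k) |:
  [set kap in I0 | leads_to D kap (lshift K0 (sigma k)) &&
     [forall k' : 'I_K1,
        leads_to D kap (lshift K0 (sigma k')) ==> (k' <= k)%N]])%SET.

Definition zero_components (R : realType) (n m K : nat)
    (C : 'I_K -> {set 'I_n} * {set 'I_m}) (Lam : 'I_n -> R) : {set 'I_K} :=
  [set k | class_total C Lam k == 0]%SET.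

Definition admissible_order (R : realType) (n m K1 K0 : nat) (Gam : 'I_n -> R)
    (C : 'I_(K1 + K0) -> {set 'I_n} * {set 'I_m}) (sigma : 'S_K1) : Prop :=
  forall k : 'I_K1,
    0 < \sum_(l < K1 | (l <= k)%N) class_total C Gam (lshift K0 (sigma l)).

(* sum_{l <= kap} gamma~_{comps(sigma, l)} *)
Definition cumulative_slack (R : realType) (n m K1 K0 : nat)
    (Lam Gam : 'I_n -> R) (C : 'I_(K1 + K0) -> {set 'I_n} * {set 'I_m})
    (D : rel 'I_(K1 + K0)) (sigma : 'S_K1) (kap : 'I_K1) : R :=
  \sum_(l < K1 | (l <= kap)%N)
    \sum_(k in comps D (zero_components C Lam) sigma l) class_total C Gam k.

(* Through comps, w_sigma depends on the DAG as well as on sigma as soon as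
   some component has no server. *)
Definition order_delay (R : realType) (n m K1 K0 : nat) (mu : 'I_m -> R)
    (Lam Gam : 'I_n -> R) (C : 'I_(K1 + K0) -> {set 'I_n} * {set 'I_m})
    (D : rel 'I_(K1 + K0)) (sigma : 'S_K1) : R :=
  \sum_(kap < K1)
    (\sum_(k < K1 | (k <= kap)%N) server_total C mu (lshift K0 (sigma k)))
      / cumulative_slack Lam Gam C D sigma kap.

Definition order_weight (R : realType) (n m K1 K0 : nat)
    (Lam Gam : 'I_n -> R) (C : 'I_(K1 + K0) -> {set 'I_n} * {set 'I_m})
    (D : rel 'I_(K1 + K0)) (sigma : 'S_K1) : R :=
  \prod_(kap < K1) (cumulative_slack Lam Gam C D sigma kap)^-1.

Definition menu_delay (R : realType) (n m K1 K0 : nat) (mu : 'I_m -> R)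
    (Lam Gam : 'I_n -> R) (C : 'I_(K1 + K0) -> {set 'I_n} * {set 'I_m})
    (M : menu n m) : R :=
  let D := dag C M in
  let Q := order_weight Lam Gam C D in
  (\sum_j mu j)^-1 *
  \sum_(sigma : 'S_K1 | `[< topological_order D sigma >])
     Q sigma / (\sum_(tau : 'S_K1 | `[< topological_order D tau >]) Q tau)
       * order_delay mu Lam Gam C D sigma.

(* The menus of the design problem: the collection of components is fixed. *)
Definition feasible_menu (R : realType) (n m K : nat) (mu : 'I_m -> R)
    (Lam : 'I_n -> R) (lam : 'I_n -> R -> R)
    (C : 'I_K -> {set 'I_n} * {set 'I_m}) (M : menu n m) : Prop :=
  admissible_menu mu lam M /\ induces mu Lam M C.

Definition delay_minimising (R : realType) (n m K1 K0 : nat) (mu : 'I_m -> R)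
    (Lam Gam : 'I_n -> R) (lam : 'I_n -> R -> R)
    (C : 'I_(K1 + K0) -> {set 'I_n} * {set 'I_m}) (M : menu n m) : Prop :=
  feasible_menu mu Lam lam C M /\
  forall M' : menu n m, feasible_menu mu Lam lam C M' ->
    menu_delay mu Lam Gam C M <= menu_delay mu Lam Gam C M'.

(* Main.v *)
Require Import Defs.
From HB Require Import structures.
From mathcomp Require Import all_boot all_order all_algebra all_fingroup.
From mathcomp Require Import all_classical all_reals all_analysis.
From mathcomp Require Import lra.
Set Implicit Arguments.
Unset Strict Implicit.
Unset Printing Implicit Defensive.
Import Order.TTheory GRing.Theory Num.Theory.
Import numFieldNormedType.Exports.
Local Open Scope classical_set_scope.
Local Open Scope ring_scope.

(** Expanding at eps = 0, the slack of a set S of servers in a menu M is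
    slack0 M S + slack1 M S * eps + o(eps), so admissibility says that slack1 M S
    is positive whenever S is exactly saturated by the classes that only S can
    serve. Fix a topological order of the components of a feasible menu. The
    servers of its first components are exactly saturated, and the classes that
    only they can serve are those of these components together with the classes
    of zero limiting arrival rate that reach no other component. Their slack1 is
    at most the cumulative slack of the order, which is therefore positive
    (feasible_cumulative_slack_gt0). The slacks of the zero components are
    negative: dropping them shows that the order is admissible, whatever the
    menu.

    The same sign makes it best to postpone the zero components. The cumulative
    slack never exceeds the partial sum of the slacks of the ordered components,
    and at the last position it is always the sum of all slacks; these two
    bounds make up ideal_slack, which depends on the order only. Hence the delay
    of an order in any feasible menu is at least its ideal_delay
    (feasible_order_delay_ge).

    The bound is attained by chain_menu, in which a class may be served by the
    components that precede its own, and a zero class by all servers. No flow of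
    this menu leaves its component, because the first components exhaust the
    servers available to them, so the components are the prescribed ones; its
    saturated sets of servers are those of the first components and the whole
    set, so the menu is admissible exactly because the order is; and the order is
    the only one that the menu allows. The order sigma of the theorem minimises
    ideal_delay among the finitely many admissible orders. There is at least one:
    list the components by decreasing slack.

    The delay of a menu is an average of the delays of its topological orders
    with positive weights, so it is at least the minimum, with equality exactly
    when all these orders attain it. This needs a feasible menu to have a
    topological order at all, that is, its graph of components to be acyclic:
    along a cycle a small amount of flow could be shifted, which would make an arc
    between two components residual (residual_of_cycle). *)

(** * Permutations, sorting and weighted averages *)

(** Sorting the values of f, as a permutation of its arguments. *)
Lemma sorting_perm (d : Order.disp_t) (T : orderType d) (N : nat)
    (f : 'I_N -> T) :
  exists s : 'S_N, forall a b : 'I_N, (a <= b)%N -> (f (s a) <= f (s b))%O.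
Proof.
pose leT := [rel a b : 'I_N | (f a <= f b)%O].
pose t := sort leT (enum 'I_N).
have leT_total : total leT by move=> a b; exact: le_total.
have leT_trans : transitive leT by move=> a b c; exact: le_trans.
have leT_refl : reflexive leT by move=> a /=.
have sz : size t == N by rewrite size_sort size_enum_ord.
have /tuple_permP[s Es] : perm_eq (Tuple sz) (ord_tuple N).
  by rewrite /= perm_sort.
exists s => a b ab.
have nthE (x : 'I_N) : nth x t x = s x.
  rewrite [t]Es nth_mktuple.
  by rewrite tnth_ord_tuple.
have t_sorted : sorted leT t by exact: sort_sorted.
have := sorted_leq_nth leT_trans leT_refl a t_sorted.
move=> /(_ a b); rewrite !inE (eqP sz) => /(_ (ltn_ord _) (ltn_ord _) ab).
by rewrite /= nthE (set_nth_default b) ?(eqP sz)// nthE.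
Qed.

Lemma increasing_perm_ge (N : nat) (p : 'S_N) :
  (forall a b : 'I_N, (a < b)%N -> (p a < p b)%N) ->
  forall a : 'I_N, (a <= p a)%N.
Proof.
move=> p_incr [a aN]; elim: a aN => [//|a IH] aN.
have aN' : (a < N)%N by exact: ltnW.
apply: leq_ltn_trans (IH aN') _.
exact: p_incr.
Qed.

(** The inverse of p is increasing as well, so a <= p a <= a. *)
Lemma increasing_perm1 (N : nat) (p : 'S_N) :
  (forall a b : 'I_N, (a < b)%N -> (p a < p b)%N) -> p = 1%g.
Proof.
move=> p_incr; apply/permP => a; rewrite perm1; apply/val_inj/eqP => /=.
rewrite eqn_leq (increasing_perm_ge p_incr) andbT.
have pV_incr (b c : 'I_N) : (b < c)%N -> ((p^-1)%g b < (p^-1)%g c)%N.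
  move=> bc; rewrite ltnNge; apply/negP; rewrite leq_eqVlt.
  move=> /predU1P[/val_inj/perm_inj cb|/p_incr].
    by rewrite cb ltnn in bc.
  by rewrite !permKV ltnNge (ltnW bc).
by have := increasing_perm_ge pV_incr (p a); rewrite permK.
Qed.

(** The witness i0 is needed: over an empty index set the average is 0. *)
Lemma weighted_average_ge (R : realFieldType) (I : finType) (P : pred I)
    (q w : I -> R) (d : R) (i0 : I) :
  P i0 -> (forall i, P i -> 0 < q i) -> (forall i, P i -> d <= w i) ->
  d <= \sum_(i | P i) q i / (\sum_(j | P j) q j) * w i.
Proof.
move=> Pi0 q_gt0 w_ge.
have Q_gt0 : 0 < \sum_(j | P j) q j.
  rewrite (bigD1 i0)//= ltr_pwDl ?q_gt0//.
  by apply: sumr_ge0 => i /andP[/q_gt0/ltW].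
have {1}-> : d = \sum_(i | P i) q i / (\sum_(j | P j) q j) * d.
  by rewrite -mulr_suml -mulr_suml divff ?mul1r ?gt_eqF.
apply: ler_sum => i Pi; apply: ler_wpM2l; last exact: w_ge.
by rewrite divr_ge0 ?ltW ?q_gt0.
Qed.

Lemma weighted_average_eq (R : realFieldType) (I : finType) (P : pred I)
    (q w : I -> R) (d : R) (i0 : I) :
  P i0 -> (forall i, P i -> 0 < q i) -> (forall i, P i -> d <= w i) ->
  \sum_(i | P i) q i / (\sum_(j | P j) q j) * w i = d <->
  (forall i, P i -> w i = d).
Proof.
move=> Pi0 q_gt0 w_ge.
have Q_gt0 : 0 < \sum_(j | P j) q j.
  rewrite (bigD1 i0)//= ltr_pwDl ?q_gt0//.
  by apply: sumr_ge0 => i /andP[/q_gt0/ltW].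
have dE : d = \sum_(i | P i) q i / (\sum_(j | P j) q j) * d.
  by rewrite -mulr_suml -mulr_suml divff ?mul1r ?gt_eqF.
split=> [avg i Pi|w_eq]; last first.
  by rewrite [RHS]dE; apply: eq_bigr => i Pi; rewrite w_eq.
have : \sum_(i | P i) q i / (\sum_(j | P j) q j) * (w i - d) = 0.
  under eq_bigr do rewrite mulrBr.
  by rewrite big_split/= sumrN avg -dE subrr.
move/psumr_eq0P => /(_ _ _ Pi)/eqP; rewrite mulf_eq0.
have -> : (q i / (\sum_(j | P j) q j) == 0) = false.
  by apply/gt_eqF/divr_gt0; rewrite ?q_gt0.
rewrite /= subr_eq0 => /(_ _)/eqP; apply => j Pj.
by rewrite mulr_ge0 ?subr_ge0 ?w_ge// divr_ge0// ltW// q_gt0.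
Qed.

(** * Expansion of the slack in heavy traffic *)

Section Slack.
Variables (R : realType) (n m : nat) (mu : 'I_m -> R).
Variables (Lam Gam : 'I_n -> R) (lam : 'I_n -> R -> R).
Hypothesis lam_expansion : forall i,
  lam i = (fun eps => Lam i - Gam i * eps) +o_ (0^'+) (fun eps => eps).

(** The constant coefficient of the expansion at 0 of the slack of S. *)
Definition slack0 (M : menu n m) (S : {set 'I_m}) : R :=
  \sum_(j in S) mu j - \sum_(i in only_served_by M S) Lam i.

(** Its coefficient of order 1; it is a sum with positive sign because the
    arrival rates are Lam - Gam * eps. *)
Definition slack1 (M : menu n m) (S : {set 'I_m}) : R :=
  \sum_(i in only_served_by M S) Gam i.

Lemma slack_expansion (M : menu n m) (S : {set 'I_m}) (e : R) : 0 < e ->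
  \forall eps \near 0^'+,
    `|slack mu lam M S eps - (slack0 M S + slack1 M S * eps)| <= e * eps.
Proof.
move=> e_gt0.
(* The error e * eps is shared among the classes; n.+1 avoids a division by 0. *)
have near_lam (i : 'I_n) : \forall eps \near 0^'+,
    `|lam i eps - (Lam i - Gam i * eps)| <= e / n.+1%:R * eps.
  have := eqaddoE (lam_expansion i).
  move=> /eqaddoP /(_ (e / n.+1%:R)); rewrite divr_gt0// => /(_ isT) h.
  have pos : \forall eps \near (0:R)^'+, 0 < eps by exact: nbhs_right_gt.
  near=> eps.
  have eps_gt0 : 0 < eps by near: eps.
  have : `|(lam i - (fun eps => Lam i - Gam i * eps)) eps|
     <= e / n.+1%:R * `|eps| by near: eps.
  by rewrite (gtr0_norm eps_gt0).
have all_lam : \forall eps \near 0^'+, forall i : 'I_n,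
    `|lam i eps - (Lam i - Gam i * eps)| <= e / n.+1%:R * eps.
  exact: filter_forall.
near=> eps.
have eps_gt0 : 0 < eps by near: eps; exact: nbhs_right_gt.
have H : forall i : 'I_n,
    `|lam i eps - (Lam i - Gam i * eps)| <= e / n.+1%:R * eps by near: eps.
have -> : slack mu lam M S eps - (slack0 M S + slack1 M S * eps) =
    - \sum_(i in only_served_by M S) (lam i eps - (Lam i - Gam i * eps)).
  rewrite !sumrB /slack /slack0 /slack1 mulr_suml; lra.
rewrite normrN; apply: (le_trans (ler_norm_sum _ _ _)).
apply: (@le_trans _ _ (\sum_(i in only_served_by M S) (e / n.+1%:R * eps))).
  by apply: ler_sum => i _; exact: H.
rewrite sumr_const -[leLHS]mulr_natr mulrAC ler_pM2r// -mulrA ler_piMr ?(ltW e_gt0)//.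
rewrite mulrC ler_pdivrMr// mul1r ler_nat.
by apply: leqW; rewrite -[X in (_ <= X)%N](card_ord n) max_card.
Unshelve. all: by end_near. Qed.

Lemma Omega_slack_gt0 (M : menu n m) (S : {set 'I_m}) :
  slack0 M S = 0 -> Omega_eps (slack mu lam M S) -> 0 < slack1 M S.
Proof.
move=> A0 [c c_gt0 Hc]; rewrite ltNge; apply/negP => B_le0.
have c2_gt0 : 0 < c / 2 by rewrite divr_gt0.
suff : \forall eps \near (0:R)^'+, False.
  by move=> /filter_ex[].
have He := slack_expansion M S c2_gt0.
near=> eps.
have eps_gt0 : 0 < eps by near: eps; exact: nbhs_right_gt.
have : c * eps <= slack mu lam M S eps by near: eps.
have : `|slack mu lam M S eps - (slack0 M S + slack1 M S * eps)|
   <= c / 2 * eps by near: eps.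
rewrite A0 ler_norml => /andP[_ h1] h2; nra.
Unshelve. all: by end_near. Qed.

Lemma Omega_slack (M : menu n m) (S : {set 'I_m}) :
  0 < slack0 M S \/ slack0 M S = 0 /\ 0 < slack1 M S ->
  Omega_eps (slack mu lam M S).
Proof.
move=> H; case: H => [A_gt0|[A0 B_gt0]].
- exists 1 => //.
  (* For eps < slack0 / b the constant term exceeds (2 + |slack1|) * eps. *)
  pose b := 2 + `|slack1 M S|.
  have b_gt0 : 0 < b by rewrite /b ltr_pwDl.
  have He := slack_expansion M S ltr01.
  have small : \forall eps \near (0:R)^'+, eps < slack0 M S / b.
    by apply: nbhs_right_lt; rewrite divr_gt0.
  near=> eps.
  have eps_gt0 : 0 < eps by near: eps; exact: nbhs_right_gt.
  have : eps < slack0 M S / b by near: eps.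
  rewrite ltr_pdivlMr// /b => h1.
  have : `|slack mu lam M S eps - (slack0 M S + slack1 M S * eps)|
    <= 1 * eps by near: eps.
  rewrite ler_norml => /andP[h2 _].
  have := ler_norm (- slack1 M S); rewrite normrN => h3.
  nra.
- exists (slack1 M S / 2); first by rewrite divr_gt0.
  have e_gt0 : 0 < slack1 M S / 2 by rewrite divr_gt0.
  have He := slack_expansion M S e_gt0.
  near=> eps.
  have : `|slack mu lam M S eps - (slack0 M S + slack1 M S * eps)|
    <= slack1 M S / 2 * eps by near: eps.
  rewrite A0 ler_norml => /andP[h2 _]; lra.
Unshelve. all: by end_near. Qed.

End Slack.

(** * Components and flows *)

Section Components.
Variables (R : realType) (n m K : nat) (mu : 'I_m -> R) (Lam : 'I_n -> R).
Implicit Types (M : menu n m) (C : 'I_K -> {set 'I_n} * {set 'I_m}).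
Implicit Types (comp : 'I_n + 'I_m -> 'I_K).

Local Notation resconn M := (connect (bipartite_edge (residual mu Lam M))).

(** A collection C of components is handled through the map comp that sends a
    node of the bipartite graph to the index of its component. *)
Definition indexed_by C comp :=
  (forall k, C k = ([set i | comp (inl i) == k], [set j | comp (inr j) == k])%SET)
  /\ (forall k, exists u, comp u = k).

(** The fibres of comp are the connected components of the residual graph of M. *)
Definition residual_components M comp :=
  forall u v, (comp u == comp v) = resconn M u v.

Lemma bipartite_edge_sym (B : menu n m) : symmetric (bipartite_edge B).
Proof. by move=> [i|j] [i'|j']. Qed.

Lemma induces_index M C : induces mu Lam M C ->
  exists comp, indexed_by C comp /\ residual_components M comp.
Proof.
move=> [C_inj C_crp].
have conn_sym : connect_sym (bipartite_edge (residual mu Lam M)).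
  exact/sym_connect_sym/bipartite_edge_sym.
pose cell u := ([set i | resconn M u (inl i)]%SET, [set j | resconn M u (inr j)]%SET).
have /fin_all_exists[comp compE] u : exists k, C k = cell u.
  have : cell u \in crp_components mu Lam M by apply/imsetP; exists u.
  by rewrite -C_crp => /imsetP[k _ ->]; exists k.
have comp_conn u v : (comp u == comp v) = resconn M u v.
  apply/eqP/idP => [uv|uv].
    have : cell u = cell v by rewrite -!compE uv.
    case: v {uv} => [i|j] [E1 E2].
      have : i \in [set i0 | resconn M (inl i) (inl i0)]%SET by rewrite inE.
      by rewrite -E1 inE.
    have : j \in [set i0 | resconn M (inr j) (inr i0)]%SET by rewrite inE.
    by rewrite -E2 inE.
  apply: C_inj; rewrite !compE /cell.
  by congr (_, _); apply/finset.setP => x; rewrite !inE (same_connect conn_sym uv).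
have C_cell k : exists2 u, C k = cell u & comp u = k.
  have : C k \in crp_components mu Lam M by rewrite -C_crp; apply/imsetP; exists k.
  move=> /imsetP[u _ Ck]; exists u => //.
  by apply: C_inj; rewrite compE.
exists comp; split=> //; split=> k; last by have [u _ <-] := C_cell k; exists u.
have [u -> <-] := C_cell k.
by congr (_, _); apply/finset.setP => x; rewrite !inE -comp_conn eq_sym.
Qed.

Lemma index_unique C comp comp' :
  indexed_by C comp -> indexed_by C comp' -> comp =1 comp'.
Proof.
move=> [E _] [E' _] [i|j].
- have : i \in (C (comp (inl i))).1 by rewrite E /= inE.
  by rewrite E' /= inE => /eqP.
- have : j \in (C (comp (inr j))).2 by rewrite E /= inE.
  by rewrite E' /= inE => /eqP.
Qed.

Lemma induces_residual_components M C comp :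
  indexed_by C comp -> induces mu Lam M C <-> residual_components M comp.
Proof.
move=> C_comp; split=> [/induces_index[comp' [C_comp' H]]|H].
  have E := index_unique C_comp C_comp'.
  by move=> u v; rewrite !E H.
have [CE comp_surj] := C_comp; split=> [k k'|].
  have [u <-] := comp_surj k; rewrite !CE => -[E1 E2].
  case: u E1 E2 => [i E1 _|j _ E2].
    have : i \in [set i0 | comp (inl i0) == comp (inl i)]%SET by rewrite inE.
    by rewrite E1 inE => /eqP.
  have : j \in [set i0 | comp (inr i0) == comp (inr j)]%SET by rewrite inE.
  by rewrite E2 inE => /eqP.
have cellE u : C (comp u) =
    ([set i | resconn M u (inl i)]%SET, [set j | resconn M u (inr j)]%SET).
  by rewrite CE; congr (_, _); apply/finset.setP => x; rewrite !inE eq_sym H.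
apply/finset.setP => c; apply/imsetP/imsetP => [[k _ ->]|[u _ ->]].
  by have [u <-] := comp_surj k; exists u => //; rewrite cellE.
by exists (comp u) => //; rewrite cellE.
Qed.

Hypothesis Lam_mu : \sum_i Lam i = \sum_j mu j.

(** The total arrival rate equals the total service rate, so the capacity
    constraints of a flow are all tight. *)
Lemma flows_saturate M f : flows mu Lam M f -> forall j, \sum_i f i j = mu j.
Proof.
move=> [f_ge0 f_col f_row f_supp] j.
have : \sum_j (mu j - \sum_i f i j) = 0.
  rewrite sumrB -Lam_mu exchange_big/=.
  by under [X in _ - X]eq_bigr do rewrite f_row; rewrite subrr.
move/psumr_eq0P => /(_ _ j isT)/eqP; rewrite subr_eq0 eq_sym => /(_ _)/eqP.
by apply => j' _; rewrite subr_ge0.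
Qed.

Lemma flows_residual M f i j : flows mu Lam M f -> 0 < f i j -> residual mu Lam M i j.
Proof. by move=> Hf fij; rewrite mxE; apply/asboolP; exists f. Qed.

Lemma residual_menu M i j : residual mu Lam M i j -> M i j.
Proof.
rewrite mxE => /asboolP[f [_ _ _ f_supp]].
by apply: contraTT => /negbTE/f_supp ->; rewrite ltxx.
Qed.

Lemma residual_same_component M comp i j : residual_components M comp ->
  residual mu Lam M i j -> comp (inl i) = comp (inr j).
Proof. by move=> H ij; apply/eqP; rewrite H; apply: connect1. Qed.

(** Flows do not leave components, and they exhaust the servers. *)
Lemma component_balance M comp (P : pred 'I_K) :
  flows mu Lam M !=set0 -> residual_components M comp ->
  \sum_(i | P (comp (inl i))) Lam i = \sum_(j | P (comp (inr j))) mu j.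
Proof.
move=> [f Hf] H; have [f_ge0 f_col f_row f_supp] := Hf.
transitivity (\sum_i \sum_j if P (comp (inl i)) then f i j else 0).
  rewrite big_mkcond; apply: eq_bigr => i _.
  by case: ifP => _; rewrite ?f_row// big1.
transitivity (\sum_i \sum_j if P (comp (inr j)) then f i j else 0).
  apply: eq_bigr => i _; apply: eq_bigr => j _.
  have [->|fij] := eqVneq (f i j) 0; first by rewrite !if_same.
  have fij_gt0 : 0 < f i j by rewrite lt_neqAle eq_sym fij f_ge0.
  by rewrite (residual_same_component H (flows_residual Hf fij_gt0)).
rewrite exchange_big [RHS]big_mkcond; apply: eq_bigr => j _.
by case: ifP => _; rewrite ?(flows_saturate Hf)// big1.
Qed.

(** A flow that uses every residual arc exists, since flows form a convex set. *)
Lemma exists_full_flow M : flows mu Lam M !=set0 ->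
  exists2 f, flows mu Lam M f & forall i j, residual mu Lam M i j -> 0 < f i j.
Proof.
move=> [f0 Hf0].
suff full_on (s : seq ('I_n * 'I_m)) : exists2 f, flows mu Lam M f &
    forall p, p \in s -> residual mu Lam M p.1 p.2 -> 0 < f p.1 p.2.
  have [f Hf f_pos] := full_on (enum {: 'I_n * 'I_m}).
  exists f => // i j res.
  have ij_enum : (i, j) \in enum {: 'I_n * 'I_m} by rewrite mem_enum.
  exact: f_pos ij_enum res.
elim: s => [|[i j] s [f Hf f_pos]]; first by exists f0.
have [res|nres] := boolP (residual mu Lam M i j); last first.
  exists f => // p; rewrite inE => /predU1P[-> /= res|]; last exact: f_pos.
  by rewrite res in nres.
move: (res); rewrite mxE => /asboolP[g Hg gij].
have [f_ge0 f_col f_row f_supp] := Hf.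
have [g_ge0 g_col g_row g_supp] := Hg.
exists (\matrix_(a, b) ((f a b + g a b) / 2)); first split.
- by move=> a b; rewrite mxE divr_ge0// addr_ge0.
- move=> b; under eq_bigr do rewrite mxE.
  rewrite -mulr_suml big_split/=.
  by have := f_col b; have := g_col b; lra.
- move=> a; under eq_bigr do rewrite mxE.
  rewrite -mulr_suml big_split/= f_row g_row; lra.
- by move=> a b Mab; rewrite mxE f_supp// g_supp// addr0 mul0r.
move=> p; rewrite inE => /predU1P[-> _|ps pres]; rewrite mxE /= divr_gt0//.
  by rewrite ltr_wpDl.
by rewrite ltr_pwDl// f_pos.
Qed.

End Components.

(** * Acyclicity of the graph of components *)

Section Walks.
Variables (R : realType) (n m K : nat) (mu : 'I_m -> R) (Lam : 'I_n -> R).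
Variable M : menu n m.

(** The arcs along which a flow that uses all residual arcs can be modified:
    the flow may grow on all arcs of the menu, taken from class to server, and
    decrease on residual arcs, taken from server to class. *)
Definition augmenting_arc : rel ('I_n + 'I_m) := fun u v =>
  match u, v with
  | inl i, inr j => M i j
  | inr j, inl i => residual mu Lam M i j
  | _, _ => false
  end.

Lemma augmenting_arc_residual u v :
  bipartite_edge (residual mu Lam M) u v -> augmenting_arc u v.
Proof. by case: u v => [i|j] [i'|j']//= /residual_menu. Qed.

Lemma sum_delta_mx_row (a : R) (i0 i : 'I_n) (j0 : 'I_m) :
  \sum_j (a *: delta_mx i0 j0 : 'M[R]_(n, m)) i j = a * (i0 == i)%:R.
Proof.
rewrite (bigD1 j0)//= big1 ?addr0 ?mxE ?eqxx ?andbT 1?eq_sym// => j jj0.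
by rewrite !mxE (negbTE jj0) andbF mulr0.
Qed.

Lemma sum_delta_mx_col (a : R) (i0 : 'I_n) (j j0 : 'I_m) :
  \sum_i (a *: delta_mx i0 j0 : 'M[R]_(n, m)) i j = a * (j0 == j)%:R.
Proof.
rewrite (bigD1 i0)//= big1 ?addr0 ?mxE ?eqxx ?andbT 1?eq_sym// => i ii0.
by rewrite !mxE (negbTE ii0) mulr0.
Qed.

(** Pushing one unit along each arc of a walk from u to v, counted with
    multiplicity, changes the row and column sums at the ends only. *)
Lemma walk_flow (u v : 'I_n + 'I_m) : connect augmenting_arc u v ->
  exists g : 'M[R]_(n, m),
    [/\ forall i j, M i j = false -> g i j = 0,
        forall i j, ~~ residual mu Lam M i j -> 0 <= g i j,
        forall i, \sum_j g i j = (u == inl i)%:R - (v == inl i)%:R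
      & forall j, \sum_i g i j = (v == inr j)%:R - (u == inr j)%:R].
Proof.
move=> /connectP[p]; elim: p u => [|w p IH] u /=.
  move=> _ ->; exists 0; split=> *; rewrite ?mxE ?subrr//.
  - by under eq_bigr do rewrite mxE; rewrite big1_eq.
  - by under eq_bigr do rewrite mxE; rewrite big1_eq.
move=> /andP[uw wp] v_last.
have [g [g_supp g_ge0 g_row g_col]] := IH w wp v_last.
case: u w uw g_row g_col {IH wp v_last} => [i0|j0] [i1|j1]//= Mij g_row g_col.
- exists (g + 1 *: delta_mx i0 j1); split.
  + move=> i j Mf; rewrite !mxE g_supp// add0r.
    by case: eqP Mf => [->|]; case: eqP => [->|]; rewrite ?Mij ?mulr0.
  + move=> i j /g_ge0 gij; rewrite !mxE addr_ge0// mulr_ge0//.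
  + move=> i; under eq_bigr do rewrite mxE.
    by rewrite big_split/= g_row sum_delta_mx_row mul1r; lra.
  + move=> j; under eq_bigr do rewrite mxE.
    rewrite big_split/= g_col sum_delta_mx_col mul1r.
    by rewrite /eq_op/= -/eq_op; lra.
- exists (g + (-1) *: delta_mx i1 j0); split.
  + move=> i j Mf; rewrite !mxE g_supp// add0r.
    have := residual_menu Mij.
    by case: eqP Mf => [->|]; case: eqP => [->|]; rewrite ?mulr0// => ->.
  + move=> i j nres; rewrite !mxE.
    have -> : (i == i1) && (j == j0) = false.
      by apply/negP => /andP[/eqP ii /eqP jj]; rewrite ii jj Mij in nres.
    by rewrite mulr0 addr0 g_ge0.
  + move=> i; under eq_bigr do rewrite mxE.
    rewrite big_split/= g_row sum_delta_mx_row.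
    by rewrite /eq_op/= -/eq_op; lra.
  + move=> j; under eq_bigr do rewrite mxE.
    rewrite big_split/= g_col sum_delta_mx_col.
    by rewrite /eq_op/= -/eq_op; lra.
Qed.

(** Pushing a small amount along a cycle of augmenting arcs gives another flow,
    which is positive on the arcs that the cycle adds. *)
Lemma residual_of_cycle (i0 : 'I_n) (j0 : 'I_m) :
  flows mu Lam M !=set0 -> M i0 j0 ->
  connect augmenting_arc (inr j0) (inl i0) -> residual mu Lam M i0 j0.
Proof.
move=> M_flows Mij0 /walk_flow[g [g_supp g_ge0 g_row g_col]].
have [f Hf f_pos] := exists_full_flow M_flows.
have [f_ge0 f_col f_row f_supp] := Hf.
apply/negPn/negP => nres; move: (nres) => /negP; apply.
pose h := g + 1 *: delta_mx i0 j0.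
have h_supp i j : M i j = false -> h i j = 0.
  move=> Mf; rewrite !mxE g_supp// add0r.
  by case: eqP Mf => [->|]; case: eqP => [->|]; rewrite ?Mij0 ?mulr0.
have h_ge0 i j : ~~ residual mu Lam M i j -> 0 <= h i j.
  by move=> /g_ge0 gij; rewrite !mxE addr_ge0// mulr_ge0.
have h_row i : \sum_j h i j = 0.
  under eq_bigr do rewrite mxE.
  rewrite big_split/= g_row sum_delta_mx_row.
  by rewrite /eq_op/= -/eq_op; lra.
have h_col j : \sum_i h i j = 0.
  under eq_bigr do rewrite mxE.
  rewrite big_split/= g_col sum_delta_mx_col.
  by rewrite /eq_op/= -/eq_op; lra.
have h_pos : 0 < h i0 j0.
  by rewrite !mxE !eqxx mulr1 ltr_wpDl ?g_ge0.
(* The amount pushed is S^-1: S bounds all the ratios |h i j| / f i j, which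
   vanish where f i j = 0. *)
pose S := 1 + \sum_i \sum_j `|h i j| / f i j.
have term_ge0 i j : 0 <= `|h i j| / f i j by rewrite divr_ge0.
have S_gt0 : 0 < S by rewrite ltr_pwDl// !sumr_ge0// => i _; rewrite sumr_ge0.
have h_small i j : residual mu Lam M i j -> `|h i j| / f i j <= S.
  move=> _; rewrite /S (bigD1 i)//= (bigD1 j)//=.
  have A : 0 <= \sum_(j' | j' != j) `|h i j'| / f i j' by rewrite sumr_ge0.
  have B : 0 <= \sum_(i' | i' != i) \sum_j `|h i' j| / f i' j.
    by rewrite sumr_ge0// => i' _; rewrite sumr_ge0.
  lra.
apply: (@flows_residual _ _ _ _ _ _ (f + S^-1 *: h)); last first.
  by rewrite mxE [X in _ + X]mxE ltr_wpDl// mulr_gt0 ?invr_gt0.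
split.
- move=> i j; rewrite mxE [X in _ + X]mxE.
  have [res|nres'] := boolP (residual mu Lam M i j); last first.
    by rewrite addr_ge0// mulr_ge0 ?h_ge0// invr_ge0 ltW.
  have := h_small i j res; rewrite ler_pdivrMr ?f_pos// => hS.
  have : `|S^-1 * h i j| <= f i j.
    by rewrite normrM gtr0_norm ?invr_gt0// mulrC ler_pdivrMr// mulrC.
  by rewrite ler_norml => /andP[]; lra.
- move=> j; under eq_bigr do rewrite mxE [X in _ + X]mxE.
  by rewrite big_split/= -mulr_sumr h_col mulr0 addr0.
- move=> i; under eq_bigr do rewrite mxE [X in _ + X]mxE.
  by rewrite big_split/= -mulr_sumr h_row mulr0 addr0.
- by move=> i j Mf; rewrite mxE [X in _ + X]mxE h_supp// f_supp// mulr0 addr0.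
Qed.

Variables (C : 'I_K -> {set 'I_n} * {set 'I_m}) (comp : 'I_n + 'I_m -> 'I_K).
Hypothesis C_comp : indexed_by C comp.

Lemma dagP (k1 k2 : 'I_K) : reflect
  (exists i j, [/\ comp (inl i) = k1, comp (inr j) = k2, M i j & k2 != k1])
  (dag C M k1 k2).
Proof.
have [CE _] := C_comp; apply: (iffP andP) => [[k12 /existsP[i /andP[]]]|].
  rewrite CE inE => /eqP ik /existsP[j /andP[]]; rewrite CE inE => /eqP jk Mij.
  by exists i, j.
move=> [i [j [ik jk Mij k12]]]; split=> //; apply/existsP; exists i.
rewrite CE inE ik eqxx; apply/existsP; exists j.
by rewrite CE inE jk eqxx.
Qed.

Hypothesis M_comp : residual_components mu Lam M comp.

Lemma connect_component u v : comp u = comp v -> connect augmenting_arc u v.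
Proof.
move/eqP; rewrite M_comp; apply: connect_sub => {}u {}v uv.
exact/connect1/augmenting_arc_residual.
Qed.

(** A path between components lifts to an augmenting walk between any two of
    their nodes. *)
Lemma connect_dag (k k' : 'I_K) u v :
  connect (dag C M) k k' -> comp u = k -> comp v = k' ->
  connect augmenting_arc u v.
Proof.
move=> /connectP[p]; elim: p k u => [|k1 p IH] k u /=.
  by move=> _ -> uk vk; apply: connect_component; rewrite uk vk.
move=> /andP[/dagP[i [j [ik jk Mij _]]] k1p] k'_last uk vk'.
apply: (@connect_trans _ _ (inl i)); first by apply: connect_component; rewrite uk ik.
apply: (@connect_trans _ _ (inr j)); first exact: connect1.
exact: IH k1p k'_last jk vk'.
Qed.

Lemma dag_acyclic (k : 'I_K) : flows mu Lam M !=set0 ->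
  ~~ leads_to (dag C M) k k.
Proof.
move=> M_flows; apply/negP => /existsP[k' /andP[/dagP[i [j [ik jk Mij kk']]] k'k]].
have /(residual_same_component M_comp) : residual mu Lam M i j.
  exact/residual_of_cycle/(connect_dag k'k).
by rewrite ik jk => E; rewrite E eqxx in kk'.
Qed.

End Walks.

Lemma leads_to_trans (K : nat) (D : rel 'I_K) : transitive (leads_to D).
Proof.
move=> b a c /existsP[x /andP[ax xb]] /existsP[y /andP[b_y yc]].
apply/existsP; exists x; rewrite ax (connect_trans xb)//.
exact: connect_trans (connect1 b_y) yc.
Qed.

(** Sort the vertices by the number of vertices that they lead to. *)
Lemma exists_topological_order (K1 K0 : nat) (D : rel 'I_(K1 + K0)) :
  (forall k, ~~ leads_to D k k) -> exists sigma : 'S_K1, topological_order D sigma.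
Proof.
move=> D_acyclic.
pose h (k : 'I_K1) := #|[set k' | leads_to D (lshift K0 k) k']%SET|.
have [s s_mono] := sorting_perm h.
exists s => k1 k2 k12; rewrite ltnNge; apply/negP => /s_mono.
rewrite !permKV leEnat leqNgt => /negP; apply.
apply/proper_card/properP; split.
  apply/fintype.subsetP => k; rewrite !inE; exact: leads_to_trans.
by exists (lshift K0 k2); rewrite !inE.
Qed.

(** * Positions of components in an order and cumulative slacks *)

Section Rank.
Variables (K1 K0 : nat).
Implicit Types (s : 'S_K1) (k : 'I_(K1 + K0)).

(** The position of a component in the order s; components with no arrivals in
    the limit, which are not ordered by s, come after all the others. *)
Definition rank s k : nat :=
  match fintype.split k with inl a => (s^-1)%g a | inr _ => K1 end.

Lemma rank_lshift s (a : 'I_K1) : rank s (lshift K0 a) = (s^-1)%g a.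
Proof. by rewrite /rank -[lshift _ _]/(unsplit (inl a)) unsplitK. Qed.

Lemma rank_lshift_perm s (a : 'I_K1) : rank s (lshift K0 (s a)) = a.
Proof. by rewrite rank_lshift permK. Qed.

Lemma rank_ge s k : (K1 <= k)%N -> rank s k = K1.
Proof.
by rewrite /rank; case: splitP => // a ->; rewrite leqNgt ltn_ord.
Qed.

Lemma lt_lshift k : (k < K1)%N -> exists a : 'I_K1, k = lshift K0 a.
Proof. by move=> kK; exists (Ordinal kK); apply: val_inj. Qed.

Lemma rank_lt s k : (rank s k < K1)%N = (k < K1)%N.
Proof.
have [kK|kK] := leqP K1 k; first by rewrite rank_ge// ltnn.
by have [a ->] := lt_lshift kK; rewrite rank_lshift ltn_ord.
Qed.

Lemma rank_inj s k k' : (k < K1)%N -> rank s k = rank s k' -> k = k'.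
Proof.
move=> kK E; have k'K : (k' < K1)%N by rewrite -(rank_lt s) -E rank_lt.
have [a ka] := lt_lshift kK; have [b k'b] := lt_lshift k'K.
move: E; rewrite ka k'b !rank_lshift => /val_inj/perm_inj ->.
by [].
Qed.

Lemma sum_prefix (V : nmodType) s (F : 'I_(K1 + K0) -> V) (kap : 'I_K1) :
  \sum_(l < K1 | (l <= kap)%N) F (lshift K0 (s l)) =
  \sum_(k | (rank s k <= kap)%N) F k.
Proof.
rewrite [RHS]big_mkcond big_split_ord/= [X in _ + X]big1 ?addr0; last first.
  by move=> b _; rewrite rank_ge ?leq_addr// leqNgt ltn_ord.
rewrite -big_mkcond/= [RHS](reindex_inj (@perm_inj _ s))/=.
by apply: eq_bigl => l; rewrite rank_lshift_perm.
Qed.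

End Rank.

Section Design.
(* The menu M0 of this section only witnesses that the components in C are those
   of some menu able to serve Lam. *)
Variables (R : realType) (n m K1 K0 : nat).
Variables (mu : 'I_m -> R) (Lam Gam : 'I_n -> R) (lam : 'I_n -> R -> R).
Variable C : 'I_(K1 + K0) -> {set 'I_n} * {set 'I_m}.
Variable comp : 'I_n + 'I_m -> 'I_(K1 + K0).
Hypothesis mu_gt0 : forall j, 0 < mu j.
Hypothesis Lam_ge0 : forall i, 0 <= Lam i.
Hypothesis Lam_mu : \sum_i Lam i = \sum_j mu j.
Hypothesis Gam_gt0 : 0 < \sum_i Gam i.
Hypothesis Gam_lt0 : forall i, Lam i = 0 -> Gam i < 0.
Hypothesis lam_expansion : forall i,
  lam i = (fun eps => Lam i - Gam i * eps) +o_ (0^'+) (fun eps => eps).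
Hypothesis C_comp : indexed_by C comp.
Variable M0 : menu n m.
Hypothesis M0_flows : flows mu Lam M0 !=set0.
Hypothesis M0_comp : residual_components mu Lam M0 comp.
Hypothesis C_index : forall k, (class_total C Lam k == 0) = (K1 <= k)%N.

Implicit Types (s : 'S_K1) (D : rel 'I_(K1 + K0)) (M : menu n m).

Local Notation cls i := (comp (inl i)).
Local Notation srv j := (comp (inr j)).

Lemma class_totalE (x : 'I_n -> R) k : class_total C x k = \sum_(i | cls i == k) x i.
Proof.
by have [CE _] := C_comp; rewrite /class_total CE; apply: eq_bigl => i; rewrite inE.
Qed.

Lemma server_totalE k : server_total C mu k = \sum_(j | srv j == k) mu j.
Proof.
by have [CE _] := C_comp; rewrite /server_total CE; apply: eq_bigl => j; rewrite inE.
Qed.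

Lemma sum_class_total (P : pred 'I_(K1 + K0)) (x : 'I_n -> R) :
  \sum_(k | P k) class_total C x k = \sum_(i | P (cls i)) x i.
Proof.
rewrite [RHS](partition_big (fun i => cls i) P)//=.
apply: eq_bigr => k Pk; rewrite class_totalE; apply: eq_bigl => i.
by case: eqP => [->|]; rewrite ?Pk ?andbF.
Qed.

Lemma balance (P : pred 'I_(K1 + K0)) :
  \sum_(i | P (cls i)) Lam i = \sum_(j | P (srv j)) mu j.
Proof. exact: (component_balance Lam_mu P M0_flows M0_comp). Qed.

Lemma server_component_lt j : (srv j < K1)%N.
Proof.
rewrite ltnNge -C_index class_totalE (balance (pred1 (srv j))) gt_eqF//.
rewrite (bigD1 j)//= ltr_pwDl// sumr_ge0// => j' _; exact: ltW.
Qed.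

Lemma zero_class i : (K1 <= cls i)%N -> Lam i = 0.
Proof.
rewrite -C_index class_totalE => /eqP/psumr_eq0P; apply=> // i' _; exact: Lam_ge0.
Qed.

Lemma component_server (k : 'I_(K1 + K0)) : (k < K1)%N -> exists j, srv j = k.
Proof.
rewrite ltnNge -C_index class_totalE (balance (pred1 k)) => /eqP mu_k.
have [j /eqP jk|no_j] := pickP (fun j => srv j == k); first by exists j.
by case: mu_k; rewrite big_pred0.
Qed.

Lemma component_class (k : 'I_(K1 + K0)) : (k < K1)%N -> exists i, cls i = k.
Proof.
rewrite ltnNge -C_index class_totalE => /eqP Lam_k.
have [i /eqP ik|no_i] := pickP (fun i => cls i == k); first by exists i.
by case: Lam_k; rewrite big_pred0.
Qed.

Lemma orders_nonempty : (0 < K1)%N.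
Proof.
have [i Lam_i|Lam0] := pickP (fun i => Lam i != 0).
  rewrite lt0n; apply: contra Lam_i; rewrite -leqn0 => K10.
  exact/eqP/zero_class/(leq_trans K10).
suff : \sum_i Gam i <= 0 by rewrite leNgt Gam_gt0.
by apply: sumr_le0 => i _; apply/ltW/Gam_lt0/eqP/negPn; rewrite Lam0.
Qed.

Lemma in_zero_components k : (k \in zero_components C Lam) = (K1 <= k)%N.
Proof. by rewrite inE C_index. Qed.

Lemma zero_component_slack_le0 (k : 'I_(K1 + K0)) :
  (K1 <= k)%N -> class_total C Gam k <= 0.
Proof.
move=> kK; rewrite class_totalE; apply: sumr_le0 => i /eqP ik.
by apply/ltW/Gam_lt0/zero_class; rewrite ik.
Qed.

(** The component k leads to ordered components, and all of them are at
    positions up to kap in s. Among the components with no servers, these are the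
    ones counted in the cumulative slack at kap. *)
Definition reaches_only D s (kap : 'I_K1) (k : 'I_(K1 + K0)) : bool :=
  [exists l, leads_to D k (lshift K0 (s l))] &&
  [forall l, leads_to D k (lshift K0 (s l)) ==> (l <= kap)%N].

Lemma cumulative_slackE D s (kap : 'I_K1) :
  cumulative_slack Lam Gam C D s kap =
  \sum_(l < K1 | (l <= kap)%N) class_total C Gam (lshift K0 (s l)) +
  \sum_(k < K1 + K0 | (K1 <= k)%N && reaches_only D s kap k) class_total C Gam k.
Proof.
pose lst k (l : 'I_K1) := leads_to D k (lshift K0 (s l)) &&
  [forall l' : 'I_K1, leads_to D k (lshift K0 (s l')) ==> (l' <= l)%N].
have -> : cumulative_slack Lam Gam C D s kap = \sum_(l < K1 | (l <= kap)%N)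
    (class_total C Gam (lshift K0 (s l)) +
     \sum_(k < K1 + K0 | (K1 <= k)%N && lst k l) class_total C Gam k).
  apply: eq_bigr => l _; rewrite /comps big_setU1/=; last first.
    by rewrite inE in_zero_components leqNgt /= ltn_ord.
  by congr (_ + _); apply: eq_bigl => k; rewrite inE in_zero_components.
rewrite big_split/=; congr (_ + _).
(* A component is counted at the last position that it leads to, and only there. *)
rewrite (exchange_big_dep (fun k : 'I_(K1 + K0) => (K1 <= k)%N))/=; last first.
  by move=> l k _ /andP[].
rewrite big_mkcondr/=; apply: eq_bigr => k kK.
have [[l kl]|no_l] := pselect (exists l, leads_to D k (lshift K0 (s l))); last first.
  rewrite big_pred0 => [|l].
    by case: ifP => // /andP[/existsP[l kl] _]; case: no_l; exists l.
  by apply/negP => /andP[_ /andP[_ /andP[kl _]]]; case: no_l; exists l.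
case: (@arg_maxnP _ l (fun l => leads_to D k (lshift K0 (s l))) val kl) => lm klm lm_max.
have lstE l' : lst k l' = (l' == lm).
  apply/andP/eqP => [[kl' /forallP l'_max]|->].
    apply/val_inj/eqP; rewrite eqn_leq; apply/andP; split; first exact: lm_max.
    exact: (implyP (l'_max lm)).
  by split=> //; apply/forallP => l2; apply/implyP; exact: lm_max.
have -> : reaches_only D s kap k = (lm <= kap)%N.
  apply/andP/idP => [[_ /forallP/(_ lm)/implyP]|lm_kap]; first exact.
  split; first by apply/existsP; exists lm.
  apply/forallP => l'; apply/implyP => kl'; exact: leq_trans (lm_max l' kl') lm_kap.
case: ifP => lm_kap; last first.
  by rewrite big_pred0// => l'; rewrite kK lstE; case: eqP => [->|]; rewrite ?lm_kap ?andbF.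
rewrite (big_pred1 lm)// => l' /=.
by rewrite kK lstE andTb andbC; case: eqP => // ->.
Qed.

(** The largest cumulative slack that the order s allows: components with no
    servers have negative slack, and are best postponed to the last position. *)
Definition ideal_slack s (kap : 'I_K1) : R :=
  if kap.+1 == K1 then \sum_i Gam i
  else \sum_(l < K1 | (l <= kap)%N) class_total C Gam (lshift K0 (s l)).

(** The delay of an order whose cumulative slacks are the ideal ones. *)
Definition ideal_delay s : R :=
  \sum_(kap < K1)
    (\sum_(k < K1 | (k <= kap)%N) server_total C mu (lshift K0 (s k)))
      / ideal_slack s kap.

(** Every component with no servers leads to a component that has some, so that
    it is counted in the slack of some position. *)
Definition zero_components_lead D :=
  forall k : 'I_(K1 + K0), (K1 <= k)%N -> exists a, leads_to D k (lshift K0 a).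

Lemma cumulative_slack_last D s (kap : 'I_K1) : zero_components_lead D ->
  kap.+1 = K1 -> cumulative_slack Lam Gam C D s kap = \sum_i Gam i.
Proof.
move=> D_lead kapK; rewrite cumulative_slackE sum_prefix.
have -> : \sum_i Gam i = \sum_k class_total C Gam k.
  exact/esym/sum_class_total.
rewrite [RHS](bigID (fun k : 'I_(K1 + K0) => (k < K1)%N))/=.
congr (_ + _); apply: eq_bigl => k; first by rewrite -ltnS kapK rank_lt.
rewrite -leqNgt; have [kK|//] := leqP K1 k; rewrite /=.
apply/andP; split.
  have [a ka] := D_lead k kK; apply/existsP; exists ((s^-1)%g a).
  by rewrite permKV.
by apply/forallP => l; apply/implyP => _; rewrite -ltnS kapK.
Qed.

Lemma cumulative_slack_le_prefix D s (kap : 'I_K1) :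
  cumulative_slack Lam Gam C D s kap <=
  \sum_(l < K1 | (l <= kap)%N) class_total C Gam (lshift K0 (s l)).
Proof.
rewrite cumulative_slackE gerDl; apply: sumr_le0 => k /andP[kK _].
exact: zero_component_slack_le0.
Qed.

Lemma cumulative_slack_le_ideal D s (kap : 'I_K1) : zero_components_lead D ->
  cumulative_slack Lam Gam C D s kap <= ideal_slack s kap.
Proof.
move=> D_lead; rewrite /ideal_slack; case: eqP => [kapK|_].
  by rewrite cumulative_slack_last.
exact: cumulative_slack_le_prefix.
Qed.

Lemma ideal_delay_le D s : zero_components_lead D ->
  (forall kap, 0 < cumulative_slack Lam Gam C D s kap) ->
  ideal_delay s <= order_delay mu Lam Gam C D s.
Proof.
move=> D_lead D_pos; apply: ler_sum => kap _; apply: ler_wpM2l.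
  apply: sumr_ge0 => k _; rewrite server_totalE.
  by apply: sumr_ge0 => j _; exact: ltW.
have slack_le := cumulative_slack_le_ideal s kap D_lead.
by rewrite lef_pV2// posrE// (lt_le_trans _ slack_le).
Qed.

Lemma order_delay_ideal D s :
  (forall kap, cumulative_slack Lam Gam C D s kap = ideal_slack s kap) ->
  order_delay mu Lam Gam C D s = ideal_delay s.
Proof. by move=> D_ideal; apply: eq_bigr => kap _; rewrite D_ideal. Qed.

(** * Menus of the design problem *)

Lemma in_only_served_by M (S : {set 'I_m}) i :
  (i \in only_served_by M S) = [forall j, M i j ==> (j \in S)].
Proof.
rewrite inE sum_nat_eq0; apply: eq_forallb => j; rewrite finset.in_setC.
by case: (M i j); case: (j \in S).
Qed.

Lemma feasible_residual M : feasible_menu mu Lam lam C M ->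
  residual_components mu Lam M comp.
Proof. by move=> [_ /(induces_residual_components _ _ _ C_comp)]. Qed.

Lemma residual_server M i : residual_components mu Lam M comp ->
  (cls i < K1)%N -> exists2 j, residual mu Lam M i j & srv j = cls i.
Proof.
move=> M_comp iK; have [j ji] := component_server iK.
have /eqP := ji; rewrite eq_sym M_comp => /connectP[[//|v p] /= /andP[iv _] _].
case: v iv => [//|j' ij']; exists j' => //.
exact/esym/(residual_same_component M_comp).
Qed.

Lemma feasible_flows M : feasible_menu mu Lam lam C M -> flows mu Lam M !=set0.
Proof.
move=> /feasible_residual M_comp.
have [i ik] := @component_class (lshift K0 (Ordinal orders_nonempty)) orders_nonempty.
have [|j] := residual_server M_comp (i := i); first by rewrite ik orders_nonempty.
by rewrite mxE => /asboolP[f Hf _] _; exists f.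
Qed.

(** With S empty, admissibility excludes classes that no server can serve: their
    limiting arrival rate would be 0, hence their slack negative. *)
Lemma feasible_served M i : feasible_menu mu Lam lam C M -> exists j, M i j.
Proof.
move=> M_feas; have M_comp := feasible_residual M_feas.
have [M_adm _] := M_feas.
have [/existsP//|/existsPn no_j] := boolP [exists j, M i j].
have iU : i \in only_served_by M finset.set0.
  by rewrite in_only_served_by; apply/forallP => j; rewrite (negbTE (no_j j)).
have U_zero i' : i' \in only_served_by M finset.set0 -> Lam i' = 0.
  rewrite in_only_served_by => /forallP i'U; apply: zero_class.
  rewrite leqNgt; apply/negP => /(residual_server M_comp)[j /residual_menu Mij _].
  by have /implyP/(_ Mij) := i'U j; rewrite finset.in_set0.
have := M_adm finset.set0; rewrite (_ : only_served_by _ _ != _); last first.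
  by apply/finset.set0Pn; exists i.
rewrite orbT => /(_ isT)/(Omega_slack_gt0 lam_expansion).
rewrite /slack0 finset.big_set0 big1 ?subrr// => /(_ erefl).
rewrite ltNge => /negP[]; apply: sumr_le0 => i' /U_zero/Gam_lt0; exact: ltW.
Qed.

Lemma feasible_zero_components_lead M : feasible_menu mu Lam lam C M ->
  zero_components_lead (dag C M).
Proof.
move=> M_feas k kK; have [_ /(_ k)[[i|j] ik]] := C_comp; last first.
  by have := server_component_lt j; rewrite ik ltnNge kK.
have [j Mij] := feasible_served i M_feas.
have [a ja] := lt_lshift (server_component_lt j).
exists a; apply/existsP; exists (srv j); rewrite -ja connect0 andbT.
apply/(dagP M C_comp); exists i, j; split=> //.
apply: contraTneq (server_component_lt j) => ->.
by rewrite -leqNgt.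
Qed.

(** The servers of the first components of a topological order are saturated by
    the classes that only they can serve, so admissibility makes the next
    coefficient of their slack positive; the cumulative slack is at least that
    coefficient. *)
Lemma feasible_cumulative_slack_gt0 M s : feasible_menu mu Lam lam C M ->
  topological_order (dag C M) s ->
  forall kap, 0 < cumulative_slack Lam Gam C (dag C M) s kap.
Proof.
move=> M_feas s_top kap; have M_comp := feasible_residual M_feas.
have [M_adm _] := M_feas.
(* The servers of the components at positions up to kap. *)
pose S := [set j | (rank s (srv j) <= kap)%N]%SET.
have arc_leads i j : M i j -> cls i != srv j -> leads_to (dag C M) (cls i) (srv j).
  move=> Mij ij; apply/existsP; exists (srv j); rewrite connect0 andbT.
  by apply/(dagP M C_comp); exists i, j; split=> //; rewrite eq_sym.
have U_cls i : (cls i < K1)%N ->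
    (i \in only_served_by M S) = (rank s (cls i) <= kap)%N.
  move=> iK; rewrite in_only_served_by; apply/forallP/idP => [iU|ikap j].
    have [j /residual_menu Mij <-] := residual_server M_comp iK.
    by have /implyP/(_ Mij) := iU j; rewrite inE.
  apply/implyP => Mij; rewrite inE.
  have [<-//|ij] := eqVneq (cls i) (srv j).
  have := arc_leads _ _ Mij ij.
  have [a ia] := lt_lshift iK; have [b jb] := lt_lshift (server_component_lt j).
  rewrite ia jb => /s_top ba; move: ikap; rewrite ia !rank_lshift.
  exact/leq_trans/ltnW.
have slack0_S : slack0 mu Lam M S = 0.
  rewrite /slack0 (eq_bigl (fun j => (rank s (srv j) <= kap)%N)); last first.
    by move=> j; rewrite inE.
  rewrite -(balance (fun k => rank s k <= kap)%N) big_mkcond.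
  rewrite [X in _ - X]big_mkcond -sumrB big1// => i _.
  have [/zero_class ->|iK] := leqP K1 (cls i); first by rewrite !if_same subrr.
  by rewrite U_cls// subrr.
have S_neq0 : S != finset.set0.
  have [|j jk] := @component_server (lshift K0 (s kap)); first exact: (ltn_ord (s kap)).
  by apply/finset.set0Pn; exists j; rewrite inE jk rank_lshift_perm.
have := M_adm S; rewrite S_neq0 => /(_ isT)/(Omega_slack_gt0 lam_expansion slack0_S).
move/lt_le_trans; apply; rewrite cumulative_slackE sum_prefix !sum_class_total.
rewrite /slack1 2![X in _ <= X + _]big_mkcond [X in _ <= _ + X]big_mkcond/=.
rewrite -big_split [X in X <= _]big_mkcond/=; apply: ler_sum => i _.
have [iK|iK] := leqP K1 (cls i); last by rewrite U_cls// addr0.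
rewrite rank_ge// leqNgt ltn_ord/= add0r.
have Gam_i : Gam i <= 0 by apply/ltW/Gam_lt0/zero_class.
(* A zero class counted in the cumulative slack can be served by S only. *)
case: ifP => iU; case: ifP => // /andP[_ /forallP i_only].
case/negP: (negbT iU); rewrite in_only_served_by; apply/forallP => j.
apply/implyP => Mij; rewrite inE.
have [b jb] := lt_lshift (server_component_lt j).
have := i_only ((s^-1)%g b); rewrite permKV -jb arc_leads//.
  by rewrite jb rank_lshift.
by apply: contraTneq (server_component_lt j) => <-; rewrite -leqNgt.
Qed.

Lemma feasible_admissible_order M s : feasible_menu mu Lam lam C M ->
  topological_order (dag C M) s -> admissible_order Gam C s.
Proof.
move=> M_feas s_top kap.
apply: lt_le_trans (feasible_cumulative_slack_gt0 M_feas s_top kap) _.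
exact: cumulative_slack_le_prefix.
Qed.

Lemma feasible_topological_order M : feasible_menu mu Lam lam C M ->
  exists s, topological_order (dag C M) s.
Proof.
move=> M_feas; apply: exists_topological_order => k.
exact: dag_acyclic C_comp (feasible_residual M_feas) k (feasible_flows M_feas).
Qed.

Lemma feasible_order_delay_ge M s : feasible_menu mu Lam lam C M ->
  topological_order (dag C M) s ->
  ideal_delay s <= order_delay mu Lam Gam C (dag C M) s.
Proof.
move=> M_feas s_top; apply: ideal_delay_le.
  exact: feasible_zero_components_lead.
exact: feasible_cumulative_slack_gt0.
Qed.

(** List the components by decreasing slack. A partial sum that ends with a
    positive term has positive terms only; otherwise the terms that it leaves out
    are nonpositive, and it is at least the total. *)
Lemma exists_admissible_order : exists s, admissible_order Gam C s.
Proof.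
pose g a := class_total C Gam (lshift K0 a).
have [s s_mono] := sorting_perm (fun a : 'I_K1 => - g a).
have g_mono (a b : 'I_K1) : (a <= b)%N -> g (s b) <= g (s a).
  by move=> /s_mono; rewrite lerN2.
have total_gt0 : 0 < \sum_(l < K1) g (s l).
  have -> : \sum_(l < K1) g (s l) = \sum_(l < K1) g l.
    by rewrite [RHS](reindex_inj (@perm_inj _ s)).
  apply: lt_le_trans Gam_gt0 _.
  rewrite -[leLHS](sum_class_total predT) big_split_ord/= gerDl.
  by apply: sumr_le0 => b _; apply: zero_component_slack_le0; exact: leq_addr.
exists s => kap; rewrite -/(g _).
have [g_pos|g_neg] := ltP 0 (g (s kap)).
  rewrite (bigD1 kap)//= ltr_pwDl// sumr_ge0// => l /andP[l_kap _].
  exact/ltW/(lt_le_trans g_pos)/g_mono.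
apply: lt_le_trans total_gt0 _.
rewrite (bigID (fun l : 'I_K1 => (l <= kap)%N))/= gerDl sumr_le0// => l.
by rewrite -ltnNge => /ltnW/g_mono/le_trans; apply.
Qed.

(** * The menu that allows a single order *)

(** Each class may be served by the servers of its own component and of all
    components that precede it in s; classes without servers of their own may be
    served by all servers. *)
Definition chain_menu s : menu n m :=
  \matrix_(i, j) (rank s (srv j) <= rank s (cls i))%N.

Lemma chain_menu_flow s f : flows mu Lam M0 f -> flows mu Lam (chain_menu s) f.
Proof.
move=> Hf; have [f_ge0 f_col f_row f_supp] := Hf; split=> // i j.
rewrite mxE => ij; apply/eqP; apply: contraFT ij => fij.
have fij_gt0 : 0 < f i j by rewrite lt_neqAle eq_sym fij f_ge0.
by rewrite (residual_same_component M0_comp (flows_residual Hf fij_gt0)).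
Qed.

(** The first components of s have no servers outside of them, and they use up
    the capacity of their own servers, so that no flow enters from later
    classes. *)
Lemma chain_menu_residual s i j :
  residual mu Lam (chain_menu s) i j -> cls i = srv j.
Proof.
move=> res; have := residual_menu res; rewrite mxE => ji.
move: res; rewrite mxE => /asboolP[f Hf fij_gt0].
have [f_ge0 f_col f_row f_supp] := Hf.
apply/eqP; apply: contraTT fij_gt0 => ij; rewrite -leNgt.
pose r := rank s (srv j).
have r_lt : (r < rank s (cls i))%N.
  rewrite ltn_neqAle ji andbT; apply: contra ij => /eqP E.
  by rewrite (rank_inj (server_component_lt j) E).
have served_inside : \sum_(i' | (rank s (cls i') <= r)%N) Lam i' =
    \sum_(j' | (rank s (srv j') <= r)%N)
      \sum_(i' | (rank s (cls i') <= r)%N) f i' j'.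
  rewrite exchange_big/=; apply: eq_bigr => i' i'r.
  rewrite -f_row [RHS]big_mkcond; apply: eq_bigr => j' _.
  case: ifPn => //; rewrite -ltnNge => rj'; apply: f_supp.
  by rewrite mxE leqNgt (leq_ltn_trans i'r rj').
have outside0 : \sum_(j' | (rank s (srv j') <= r)%N)
    \sum_(i' | ~~ (rank s (cls i') <= r)%N) f i' j' = 0.
  apply/(@addrI _ (\sum_(i' | (rank s (cls i') <= r)%N) Lam i')).
  rewrite addr0 {1}served_inside -big_split/=.
  rewrite (balance (fun k => rank s k <= r)%N).
  apply: eq_bigr => j' _; rewrite -(flows_saturate Lam_mu Hf) [RHS](bigID
    (fun i' => (rank s (cls i') <= r)%N))/=.
  by [].
have /psumr_eq0P/(_ j (leqnn _)) := outside0.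
move=> /(_ (fun _ _ => sumr_ge0 _ (fun _ _ => f_ge0 _ _))).
move=> /psumr_eq0P/(_ i); rewrite -ltnNge => /(_ (fun _ _ => f_ge0 _ _) r_lt) ->.
by [].
Qed.

Lemma chain_menu_components s : residual_components mu Lam (chain_menu s) comp.
Proof.
move=> u v; apply/idP/idP.
  rewrite M0_comp; apply: connect_sub => {}u {}v uv; apply/connect1.
  have res i j : residual mu Lam M0 i j -> residual mu Lam (chain_menu s) i j.
    rewrite !mxE => /asboolP[f Hf fij]; apply/asboolP; exists f => //.
    exact: chain_menu_flow.
  by case: u v uv => [i|j] [i'|j'] //=; exact: res.
move=> /connectP[p]; elim: p u => [|w p IH] u /=; first by move=> _ ->.
move=> /andP[uw wp] v_last; rewrite -(eqP (IH w wp v_last)).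
by case: u w uw {wp v_last} => [i|j] [i'|j'] //= /chain_menu_residual ->.
Qed.

(** An arc of the graph of chain_menu s joins a component to every earlier one. *)
Lemma chain_menu_dag s k1 k2 :
  dag C (chain_menu s) k1 k2 = (k2 < K1)%N && (rank s k2 < rank s k1)%N.
Proof.
apply/(dagP _ C_comp)/andP => [[i [j [<- <-]]]|[k2K k21]].
  rewrite mxE => ji ij; rewrite server_component_lt ltn_neqAle ji andbT.
  split=> //; apply: contra ij => /eqP/(rank_inj (server_component_lt j)) ->.
  exact: eqxx.
have [j jk2] := component_server k2K.
have [i ik1] : exists i, cls i = k1.
  have [k1K|k1K] := leqP K1 k1; last exact: component_class.
  have [_ /(_ k1)[[i|j'] uk1]] := C_comp; first by exists i.
  by have := server_component_lt j'; rewrite uk1 ltnNge k1K.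
exists i, j; split=> //; first by rewrite mxE jk2 ik1 ltnW.
by apply: contraTneq k21 => ->; rewrite ltnn.
Qed.

Lemma chain_menu_leads_to s k1 k2 :
  leads_to (dag C (chain_menu s)) k1 k2 = (k2 < K1)%N && (rank s k2 < rank s k1)%N.
Proof.
apply/existsP/idP => [[k /andP[]]|k12]; last first.
  by exists k2; rewrite chain_menu_dag k12 connect0.
move=> k1k /connectP[p]; elim: p k k1k => [|k' p IH] k k1k /=.
  by move=> _ ->; rewrite -chain_menu_dag.
move=> /andP[kk' k'p]; apply: IH k'p.
move: k1k kk'; rewrite !chain_menu_dag => /andP[_ kk1] /andP[-> k'k].
exact: ltn_trans k'k kk1.
Qed.

Lemma chain_menu_topological_order s t :
  topological_order (dag C (chain_menu s)) t <-> t = s.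
Proof.
split=> [t_top|-> k1 k2]; last first.
  by rewrite chain_menu_leads_to !rank_lshift => /andP[].
suff : (s * t^-1 = 1)%g by move=> /(congr1 (mulg^~ t)); rewrite mulgKV mul1g.
apply: increasing_perm1 => a b ab; rewrite !permM; apply: t_top.
by rewrite chain_menu_leads_to !rank_lshift_perm ab andbT /= ltn_ord.
Qed.

Lemma chain_menu_cumulative_slack s (kap : 'I_K1) :
  cumulative_slack Lam Gam C (dag C (chain_menu s)) s kap = ideal_slack s kap.
Proof.
rewrite /ideal_slack; case: eqP => [kapK|/eqP kapK].
  apply: cumulative_slack_last => // k kK; exists (Ordinal orders_nonempty).
  rewrite chain_menu_leads_to rank_lshift [rank s k]rank_ge// ltn_ord andbT.
  exact: orders_nonempty.
rewrite cumulative_slackE [X in _ + X]big1 ?addr0// => k /andP[kK].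
have lastK : (kap.+1 < K1)%N by rewrite ltn_neqAle kapK ltn_ord.
move=> /andP[_ /forallP/(_ (Ordinal lastK))].
rewrite chain_menu_leads_to rank_lshift_perm rank_ge//= lastK ltn_ord/=.
by rewrite ltnn.
Qed.

Lemma chain_menu_order_delay s :
  order_delay mu Lam Gam C (dag C (chain_menu s)) s = ideal_delay s.
Proof. exact/order_delay_ideal/chain_menu_cumulative_slack. Qed.

(** The only sets of servers that can be exactly saturated are the whole set and
    those of the first components of s; the partial sums in the admissibility of
    s are the coefficients slack1 of the latter. *)
Lemma chain_menu_feasible s : admissible_order Gam C s ->
  feasible_menu mu Lam lam C (chain_menu s).
Proof.
move=> s_adm; split; last first.
  exact/(induces_residual_components _ _ _ C_comp)/chain_menu_components.
move=> S S_nontriv; apply: (Omega_slack lam_expansion).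
(* Without a server outside of S, the slack is the total one. *)
have [j1 j1S|S_full] := pickP (fun j => j \notin S); last first.
  right.
  have ST j : j \in S by have /negbFE := S_full j.
  have UT i : i \in only_served_by (chain_menu s) S.
    by rewrite in_only_served_by; apply/forallP => j; rewrite ST implybT.
  rewrite /slack0 /slack1 (eq_bigl predT)// [X in _ - X](eq_bigl predT)//.
  by rewrite Lam_mu subrr; split=> //; rewrite (eq_bigl predT).
(* Otherwise let p be the first position that S does not fill; the classes served
   by S only are those at positions before p. *)
case: (@arg_minnP _ j1 (fun j => j \notin S) (fun j => rank s (srv j)) j1S).
move=> j0 j0S j0_min; pose p := rank s (srv j0).
have pK : (p < K1)%N by rewrite rank_lt server_component_lt.
have UE i : (i \in only_served_by (chain_menu s) S) = (rank s (cls i) < p)%N.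
  rewrite in_only_served_by; apply/forallP/idP => [iU|ip j].
    rewrite ltnNge; apply/negP => pi; have := iU j0.
    by rewrite mxE pi (negbTE j0S).
  apply/implyP; rewrite mxE => ji; apply: contraLR (leq_ltn_trans ji ip) => jS.
  by rewrite -leqNgt j0_min.
have slack0E : slack0 mu Lam (chain_menu s) S =
    \sum_(j in S | ~~ (rank s (srv j) < p)%N) mu j.
  rewrite /slack0 (eq_bigl _ _ UE) (balance (fun k => rank s k < p)%N).
  rewrite (bigID (fun j => rank s (srv j) < p)%N)/=.
  rewrite [X in X + _ - _](_ : _ = \sum_(j | (rank s (srv j) < p)%N) mu j).
    by rewrite addrAC subrr add0r.
  apply: eq_bigl => j; apply: andb_idl => jp; apply: contraLR jp => jS.
  by rewrite -leqNgt j0_min.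
have [j /andP[jS jp]|S_prefix] :=
    pickP (fun j => (j \in S) && ~~ (rank s (srv j) < p)%N).
  left; rewrite slack0E (bigD1 j) ?jS//= ltr_pwDl// sumr_ge0// => j' _.
  exact: ltW.
right; split; first by rewrite slack0E big_pred0.
have p_gt0 : (0 < p)%N.
  rewrite lt0n; apply: contraTneq S_nontriv => p0; rewrite negb_or !negbK.
  apply/andP; split; apply/eqP/finset.setP => x; rewrite finset.in_set0.
    by have := S_prefix x; rewrite p0 andbT.
  by rewrite UE p0.
have p1K : (p.-1 < K1)%N by rewrite prednK// ltnW.
have := s_adm (Ordinal p1K); rewrite sum_prefix sum_class_total /slack1.
rewrite (eq_bigl _ _ UE); congr (_ < _).
by apply: eq_bigl => i /=; rewrite -ltnS prednK.
Qed.

(** * Average delays of menus *)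

Lemma mu_total_gt0 : 0 < \sum_j mu j.
Proof.
have [|j _] := @component_server (lshift K0 (Ordinal orders_nonempty)).
  exact: orders_nonempty.
by rewrite (bigD1 j)//= ltr_pwDl// sumr_ge0// => j' _; exact: ltW.
Qed.

Lemma feasible_order_weight_gt0 M t : feasible_menu mu Lam lam C M ->
  topological_order (dag C M) t -> 0 < order_weight Lam Gam C (dag C M) t.
Proof.
move=> M_feas t_top; apply: prodr_gt0 => kap _; rewrite invr_gt0.
exact: feasible_cumulative_slack_gt0.
Qed.

Lemma chain_menu_delay s : admissible_order Gam C s ->
  menu_delay mu Lam Gam C (chain_menu s) = (\sum_j mu j)^-1 * ideal_delay s.
Proof.
move=> s_adm; rewrite /menu_delay; congr (_ * _).
have top_s t : `[< topological_order (dag C (chain_menu s)) t >] = (t == s).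
  by apply/asboolP/eqP => /chain_menu_topological_order.
rewrite !(big_pred1 s) ?chain_menu_order_delay// divff ?mul1r// gt_eqF//.
apply: feasible_order_weight_gt0; first exact: chain_menu_feasible.
exact/chain_menu_topological_order.
Qed.

Section Minimum.
(* A lower bound d of the ideal delays of admissible orders. *)
Variable d : R.
Hypothesis d_min : forall t, admissible_order Gam C t -> d <= ideal_delay t.

Lemma feasible_order_delay_ge_min M t : feasible_menu mu Lam lam C M ->
  topological_order (dag C M) t -> d <= order_delay mu Lam Gam C (dag C M) t.
Proof.
move=> M_feas t_top; apply: le_trans (feasible_order_delay_ge M_feas t_top).
exact/d_min/(feasible_admissible_order M_feas).
Qed.

Lemma menu_delay_ge M : feasible_menu mu Lam lam C M ->
  (\sum_j mu j)^-1 * d <= menu_delay mu Lam Gam C M.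
Proof.
move=> M_feas; rewrite /menu_delay ler_pM2l ?invr_gt0 ?mu_total_gt0//.
have [t /asboolP t_top] := feasible_topological_order M_feas.
apply: (weighted_average_ge t_top) => t' /asboolP t'_top.
- exact: feasible_order_weight_gt0.
- exact: feasible_order_delay_ge_min.
Qed.

Lemma menu_delay_eq M : feasible_menu mu Lam lam C M ->
  menu_delay mu Lam Gam C M = (\sum_j mu j)^-1 * d <->
  (forall t, topological_order (dag C M) t ->
     order_delay mu Lam Gam C (dag C M) t = d).
Proof.
move=> M_feas; rewrite /menu_delay.
have mu_neq0 : (\sum_j mu j)^-1 != 0 by rewrite invr_eq0 gt_eqF ?mu_total_gt0.
have [t /asboolP t_top] := feasible_topological_order M_feas.
have q_gt0 t' : `[< topological_order (dag C M) t' >] ->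
    0 < order_weight Lam Gam C (dag C M) t'.
  by move=> /asboolP; exact: feasible_order_weight_gt0.
have w_ge t' : `[< topological_order (dag C M) t' >] ->
    d <= order_delay mu Lam Gam C (dag C M) t'.
  by move=> /asboolP; exact: feasible_order_delay_ge_min.
have avg := weighted_average_eq t_top q_gt0 w_ge.
split=> [/(mulfI mu_neq0)/avg w_eq t' t'_top|w_eq].
  exact/w_eq/asboolP.
by congr (_ * _); apply/avg => t' /asboolP; exact: w_eq.
Qed.

End Minimum.

Lemma exists_best_order : exists2 s, admissible_order Gam C s &
  forall t, admissible_order Gam C t -> ideal_delay s <= ideal_delay t.
Proof.
have [s0 /asboolP s0_adm] := exists_admissible_order.
case: (@Order.TotalTheory.arg_minP _ _ _ s0
  (fun t => `[< admissible_order Gam C t >]) ideal_delay s0_adm).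
move=> s /asboolP s_adm s_min.
by exists s => // t /asboolP; exact: s_min.
Qed.

Lemma delay_minimisingP s M : admissible_order Gam C s ->
  (forall t, admissible_order Gam C t -> ideal_delay s <= ideal_delay t) ->
  feasible_menu mu Lam lam C M ->
  delay_minimising mu Lam Gam lam C M <->
  menu_delay mu Lam Gam C M = (\sum_j mu j)^-1 * ideal_delay s.
Proof.
move=> s_adm s_min M_feas; split=> [[_ M_min]|M_eq].
  apply/eqP; rewrite eq_le menu_delay_ge// andbT -(chain_menu_delay s_adm).
  exact/M_min/chain_menu_feasible.
split; first exact: M_feas.
by move=> M' M'_feas; rewrite M_eq; apply: menu_delay_ge.
Qed.

End Design.

(** * Optimal orders and menus *)

Theorem proposition6 (R : realType) (n m K1 K0 : nat)
    (mu : 'I_m -> R) (Lam Gam : 'I_n -> R) (lam : 'I_n -> R -> R) (epsp : R)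
    (C : 'I_(K1 + K0) -> {set 'I_n} * {set 'I_m})
    (mu_gt0 : forall j, 0 < mu j)
    (Lam_ge0 : forall i, 0 <= Lam i)
    (Lam_mu : \sum_i Lam i = \sum_j mu j)
    (Gam_gt0 : 0 < \sum_i Gam i)
    (Gam_lt0 : forall i, Lam i = 0 -> Gam i < 0)
    (epsp_gt0 : 0 < epsp)
    (lam_ge0 : forall i eps, 0 < eps < epsp -> 0 <= lam i eps)
    (lam_expansion : forall i,
       lam i = (fun eps => Lam i - Gam i * eps) +o_ (0^'+) (fun eps => eps))
    (* C is the collection of CRP components induced by some menu able to
       serve Lam, the components with Lambda~_k = 0 coming last *)
    (C_crp : exists2 M : menu n m,
       flows mu Lam M !=set0 & induces mu Lam M C)
    (C_index : forall k, (class_total C Lam k == 0) = (K1 <= k)%N) :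
  exists (sigma : 'S_K1) (M : menu n m),
    [/\ (* sigma is an admissible topological order, the only one M allows *)
        admissible_order Gam C sigma
        /\ (forall tau : 'S_K1,
              topological_order (dag C M) tau <-> tau = sigma),
        (* sigma minimises the delay across all admissible orders, each of
           which is allowed by some menu of the design problem *)
        forall tau : 'S_K1, admissible_order Gam C tau ->
          (exists M' : menu n m, feasible_menu mu Lam lam C M'
             /\ topological_order (dag C M') tau)
          /\ forall M' : menu n m, feasible_menu mu Lam lam C M' ->
             topological_order (dag C M') tau ->
             order_delay mu Lam Gam C (dag C M) sigma
               <= order_delay mu Lam Gam C (dag C M') tau,
        (* the menu M minimises the delay *)
        delay_minimising mu Lam Gam lam C M
      & (* delay-minimising menus are those allowing only minimising orders *)
        forall M' : menu n m, feasible_menu mu Lam lam C M' ->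
          (delay_minimising mu Lam Gam lam C M' <->
           forall tau : 'S_K1, topological_order (dag C M') tau ->
             order_delay mu Lam Gam C (dag C M') tau
               = order_delay mu Lam Gam C (dag C M) sigma)].
Proof.
have [M0 M0_flows M0_ind] := C_crp.
have [comp [C_comp M0_comp]] := induces_index M0_ind.
have [sigma s_adm s_min] :=
  exists_best_order mu Lam_ge0 Gam_gt0 Gam_lt0 C_comp C_index.
have chain_feasible tau : admissible_order Gam C tau ->
    feasible_menu mu Lam lam C (chain_menu comp tau).
  exact: (chain_menu_feasible mu_gt0 Lam_mu Gam_gt0 lam_expansion C_comp
    M0_flows M0_comp C_index).
have chain_topological tau tau' :
    topological_order (dag C (chain_menu comp tau)) tau' <-> tau' = tau.
  exact: (chain_menu_topological_order mu_gt0 Lam_mu C_comp M0_flows M0_comp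
    C_index).
have M_order : order_delay mu Lam Gam C (dag C (chain_menu comp sigma)) sigma =
    ideal_delay mu Gam C sigma.
  exact: (chain_menu_order_delay mu_gt0 Lam_ge0 Lam_mu Gam_gt0 Gam_lt0 C_comp
    M0_flows M0_comp C_index).
have min_iff M' : feasible_menu mu Lam lam C M' ->
    delay_minimising mu Lam Gam lam C M' <->
    menu_delay mu Lam Gam C M' = (\sum_j mu j)^-1 * ideal_delay mu Gam C sigma.
  exact: (delay_minimisingP mu_gt0 Lam_ge0 Lam_mu Gam_gt0 Gam_lt0 lam_expansion
    C_comp M0_flows M0_comp C_index s_adm s_min).
exists sigma, (chain_menu comp sigma); split.
- split; first exact: s_adm.
  by move=> tau; exact: chain_topological.
- move=> tau tau_adm; split.
    exists (chain_menu comp tau); split; first exact: chain_feasible.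
    exact/chain_topological.
  move=> M' M'_feas tau_top; rewrite M_order.
  exact: (feasible_order_delay_ge_min mu_gt0 Lam_ge0 Lam_mu Gam_lt0
    lam_expansion C_comp M0_flows M0_comp C_index s_min M'_feas tau_top).
- apply/min_iff; first exact: chain_feasible.
  exact: (chain_menu_delay mu_gt0 Lam_ge0 Lam_mu Gam_gt0 Gam_lt0 lam_expansion
    C_comp M0_flows M0_comp C_index s_adm).
- move=> M' M'_feas; rewrite M_order.
  apply: (iff_trans (min_iff M' M'_feas)).
  exact: (menu_delay_eq mu_gt0 Lam_ge0 Lam_mu Gam_gt0 Gam_lt0 lam_expansion
    C_comp M0_flows M0_comp C_index s_min M'_feas).
Qed.
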